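(* Let $F_1,F_2$ be polynomials with real coefficients, let $G,M>0$, $\kappa^2=32\pi G$, and define the real polynomials $$Q_0(x)=1-\kappa^2x\,[F_2(-x)+3F_1(-x)],\qquad Q_2(x)=1+\tfrac{\kappa^2x}{2}F_2(-x).$$ Assume that $Q_0$ and $Q_2$ are nonconstant, of degrees $n_0$ and $n_2$ respectively, that neither has a root in $(-\infty,0)$, and that all (possibly complex) roots of each $Q_i$ are simple. For $i\in\{0,2\}$ write the roots of $Q_i$ as $m_{(i)1}^2,\dots,m_{(i)n_i}^2$ with $\mathrm{Re}\,m_{(i)j}>0$. For $r>0$ let $$\phi(r)=\frac{iGM}{\pi r}\ \mathrm{p.v.}\!\int_{-\infty}^{+\infty}\frac{dk}{k}\,e^{ikr}\left(\frac{4}{3\,Q_2(-k^2)}-\frac{1}{3\,Q_0(-k^2)}\right)$$ (here the $i$ in the prefactor and the exponent is the imaginary unit). Then for every $r>0$ $$\phi(r)=-GM\left[\frac1r-\frac43\sum_{i=1}^{n_2}\frac{e^{-r m_{(2)i}}}{r}\prod_{j\neq i}\frac{m_{(2)j}^2}{m_{(2)j}^2-m_{(2)i}^2}+\frac13\sum_{i=1}^{n_0}\frac{e^{-r m_{(0)i}}}{r}\prod_{j\neq i}\frac{m_{(0)j}^2}{m_{(0)j}^2-m_{(0)i}^2}\right],$$ and $\phi(r)$ is a real number.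
   Context: The function $\phi$ is the modified Newtonian potential of a static point mass $M$ in the linearized higher-derivative gravity theory with Lagrangian $\sqrt{-g}\,\big(\tfrac{2}{\kappa^2}R+R\,F_1(\square)R+R_{\mu\nu}F_2(\square)R^{\mu\nu}\big)$. The roots of $Q_2$ and $Q_0$ are the squared masses of the massive spin-2 and spin-0 modes, respectively. The absence of roots in $(-\infty,0)$ expresses the absence of tachyonic modes; since also $Q_i(0)=1$, every root has a unique square root with positive real part. The symbol p.v. denotes the Cauchy principal value at $k=0$. Empty products equal $1$. *)

(* Defs.v *)
From HB Require Import structures.
From mathcomp Require Import all_boot all_order all_algebra.
From mathcomp Require Import all_classical all_reals all_analysis.
From mathcomp Require Import complex.

Set Implicit Arguments.
Unset Strict Implicit.
Unset Printing Implicit Defensive.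

Import Order.TTheory GRing.Theory Num.Theory.
Import numFieldTopology.Exports numFieldNormedType.Exports.

Local Open Scope classical_set_scope.
Local Open Scope ring_scope.
Local Open Scope complex_scope.

Definition expC (R : realType) (z : R[i]) : R[i] :=
  (expR (complex.Re z) * cos (complex.Im z))
    +i* (expR (complex.Re z) * sin (complex.Im z)).

Section PrincipalValue.
Variable R : realType.
Implicit Types (D : set R) (f : R -> R[i]).

Definition integrableC D f : Prop :=
  (@lebesgue_measure R).-integrable D (fun k => (complex.Re (f k))%:E) /\
  (@lebesgue_measure R).-integrable D (fun k => (complex.Im (f k))%:E).

Definition integralC D f : R[i] :=
  Rintegral (@lebesgue_measure R) D (fun k => complex.Re (f k))
    +i* Rintegral (@lebesgue_measure R) D (fun k => complex.Im (f k)).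

(* The regular module R[i]^o carries the topology of the complex modulus. *)
Definition truncated_integral f (e : R) : R[i]^o :=
  integralC [set k | e <= `|k|] f.

(* Only the singularity at 0 is treated as a principal value; away from it
   the integral is an absolutely convergent one. *)
Definition ex_pv f : Prop :=
  (forall e : R, 0 < e -> integrableC [set k | e <= `|k|] f) /\
  cvg (truncated_integral f e @[e --> 0^'+]).

Definition pv f : R[i] := lim (truncated_integral f e @[e --> 0^'+]).

End PrincipalValue.

Section Potential.
Variable R : realType.
Implicit Types (kappa G M r : R) (Q : {poly R}).

Definition Q0 kappa (F1 F2 : {poly R}) : {poly R} :=
  1 - kappa ^+ 2 *: ('X * (F2 \Po (- 'X) + 3 *: (F1 \Po (- 'X)))).

Definition Q2 kappa (F2 : {poly R}) : {poly R} :=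
  1 + (kappa ^+ 2 / 2) *: ('X * (F2 \Po (- 'X))).

Definition toC Q : {poly R[i]} := map_poly (real_complex R) Q.

Definition simple_roots Q : Prop :=
  forall z : R[i], root (toC Q) z -> mup z (toC Q) = 1%N.

(* m 0, ..., m (n - 1) are the square roots, with positive real part, of the
   complex roots of Q, each root being listed exactly once. *)
Definition masses_of Q (n : nat) (m : 'I_n -> R[i]) : Prop :=
  [/\ forall i, 0 < complex.Re (m i),
      injective (fun i => m i ^+ 2)
    & forall z : R[i], root (toC Q) z <-> exists i, z = m i ^+ 2].

Definition integrand kappa (F1 F2 : {poly R}) r (k : R) : R[i] :=
  expC ('i * (k * r)%:C) / k%:C *
  (4 / (3 * (Q2 kappa F2).[- k ^+ 2])
   - 1 / (3 * (Q0 kappa F1 F2).[- k ^+ 2]))%:C.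

Definition phi kappa G M (F1 F2 : {poly R}) r : R[i] :=
  'i * (G * M / (pi * r))%:C * pv (integrand kappa F1 F2 r).

Definition yukawa_sum (n : nat) (m : 'I_n -> R[i]) r : R[i] :=
  \sum_(i < n) expC (- (r%:C * m i)) / r%:C *
    \prod_(j < n | j != i) (m j ^+ 2 / (m j ^+ 2 - m i ^+ 2)).

End Potential.

(* Main.v *)
Require Import Defs.
From HB Require Import structures.
From mathcomp Require Import all_boot all_order all_algebra.
From mathcomp Require Import all_classical all_reals all_analysis.
From mathcomp Require Import measurable_realfun complex ring lra zify.

Import Order.TTheory GRing.Theory Num.Theory.
Import numFieldTopology.Exports numFieldNormedType.Exports.

Local Open Scope classical_set_scope.
Local Open Scope ring_scope.
Local Open Scope complex_scope.

(** Lagrange interpolation of the constant 1 at the roots [m_i^2] of [Q] gives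
    [1/Q(-k^2) = \sum_i c_i m_i^2 / (m_i^2 + k^2)], where [c_i] is the product in
    the Yukawa sum and [\sum_i c_i = 1].  No contour integration is used:
    [m/(m^2+k^2)] is the cosine transform of [exp(-mt)] because [Re m > 0], and
    for integrable [w] with cosine transform [w^],
    [\int_0^oo sin(rk)/k w^(k) dk = pi/2 \int_0^r w], which for [w = m exp(-mt)]
    is [pi/2 (1 - exp(-mr))].  That formula comes from Fubini after inserting
    [exp(-ek)], since [\int_0^oo exp(-ek) sin(sk)/k dk = atan(s/e)].  The real part
    of the integrand of [phi] is odd, and its imaginary part even, so only the
    latter contributes to the principal value. *)

Set Implicit Arguments.
Unset Strict Implicit.
Unset Printing Implicit Defensive.

(** * Integrals on the half-line *)

Section integrals_on_halfline.
Context {R : realType}.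
Notation mu := (@lebesgue_measure R).
Implicit Types (f g F : R -> R) (a b r s t x : R).

Lemma dominated_cvg_Rintegral (D : set R) (f_ : (R -> R)^nat) f g :
    measurable D -> (forall n, measurable_fun D (f_ n)) ->
    (forall x, D x -> f_ n x @[n --> \oo] --> f x) ->
    mu.-integrable D (EFin \o g) ->
    (forall n x, D x -> `|f_ n x| <= g x) ->
  Rintegral mu D (f_ n) @[n --> \oo] --> Rintegral mu D f.
Proof.
move=> mD mf cf ig fg.
have cfE x : D x -> (f_ n x)%:E @[n --> \oo] --> (f x)%:E.
  by move=> Dx; apply: cvg_EFin; [exact: nearW|exact: cf].
have mfE n : measurable_fun D (EFin \o f_ n) by exact/measurable_EFinP.
have fgE n x : D x -> (`|(f_ n x)%:E| <= (g x)%:E)%E.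
  by move=> Dx; rewrite lee_fin fg.
have mfl : measurable_fun D (EFin \o f) by exact: emeasurable_fun_cvg mfE cfE.
have [intf _ cvf] := @dominated_convergence _ _ _ mu D mD (fun n => EFin \o f_ n)
  (EFin \o f) (EFin \o g) mfE mfl (aeW mu cfE) ig (aeW mu (fun x n => fgE n x)).
by apply: fine_cvg; rewrite fineK //; exact: integrable_fin_num.
Qed.

Lemma integrable_le_norm (D : set R) f g : measurable D ->
    measurable_fun D f -> mu.-integrable D (EFin \o g) ->
    (forall x, D x -> `|f x| <= g x) ->
  mu.-integrable D (EFin \o f).
Proof.
move=> mD mf ig fg; apply: le_integrable ig => //; first exact/measurable_EFinP.
by move=> x Dx /=; rewrite lee_fin (le_trans (fg _ Dx)) ?ler_norm.
Qed.

Lemma continuous_is_derive f F : (forall x, is_derive x 1 F (f x)) -> continuous F.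
Proof.
by move=> dF x; apply/differentiable_continuous/derivable1_diffP/(@ex_derive _ _ _ _ _ _ _ (dF x)).
Qed.

(** The fundamental theorem holds on each []0, n.+1]]; dominated convergence with majorant [|f|]
    then passes to the half-line, so [f] may change sign. *)
Lemma Rintegral_FTC2y f F l :
    continuous f -> (forall x, is_derive x 1 F (f x)) ->
    F x @[x --> +oo] --> l -> mu.-integrable `]0, +oo[ (EFin \o f) ->
  Rintegral mu `]0, +oo[ f = l - F 0.
Proof.
move=> cf dF Fl intf.
have cF := continuous_is_derive dF.
have mf : measurable_fun setT f by exact: continuous_measurable_fun.
have FTC n : Rintegral mu `]0, n.+1%:R] f = F n.+1%:R - F 0.
  rewrite Rintegral_itv_obnd_cbnd; last first.
    apply: integrableS intf => //; apply: subset_itvl.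
    by rewrite bnd_simp.
  rewrite /Rintegral (@continuous_FTC2 _ f F) ?ltr0n//.
  - exact: continuous_subspaceT.
  - split=> [x _||].
    + exact: (@ex_derive _ _ _ _ _ _ _ (dF x)).
    + exact/cvg_at_right_filter/cF.
    + exact/cvg_at_left_filter/cF.
  - by move=> x _; rewrite derive1E; exact: (@derive_val _ _ _ _ _ _ _ (dF x)).
have l1 : Rintegral mu `]0, n.+1%:R] f @[n --> \oo] --> l - F 0.
  under eq_fun do rewrite FTC.
  apply: cvgB; last exact: cvg_cst.
  apply: (cvg_comp (fun n => n.+1%:R) F _ Fl).
  apply/cvgryPge => A; near=> n.
  rewrite (@le_trans _ _ n%:R) ?ler_nat//.
  by near: n; exact: nbhs_infty_ger.
suff l2 : Rintegral mu `]0, n.+1%:R] f @[n --> \oo] --> Rintegral mu `]0, +oo[ f.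
  by rewrite -(cvg_lim _ l1)// -(cvg_lim _ l2).
have E n : Rintegral mu `]0, n.+1%:R] f =
    Rintegral mu `]0, +oo[ (f \_ `]0, n.+1%:R]).
  rewrite -Rintegral_mkcondr; congr (Rintegral _ _ _).
  apply/seteqP; split=> x /=; rewrite !in_itv/= ?andbT; first by move=> /andP[-> ->].
  by move=> [-> /andP[_ ->]].
under eq_fun do rewrite E.
apply: (dominated_cvg_Rintegral (g := fun x => `|f x|)) => //.
- by move=> n; apply/measurable_restrict => //; exact: measurable_funTS.
- move=> x; rewrite /= in_itv/= andbT => x0.
  apply: (@cvg_near_cst).
  near=> n.
  rewrite patchT// inE /= in_itv/= x0/=.
  rewrite (@le_trans _ _ n%:R) ?ler_nat//.
  by near: n; exact: nbhs_infty_ger.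
- exact: integrable_norm.
- by move=> n x _; rewrite patchE; case: ifP => // _; rewrite normr0.
Unshelve. all: by end_near. Qed.

Lemma cvg_expRNM a (a0 : 0 < a) : expR (- (a * x)) @[x --> +oo] --> (0 : R).
Proof.
apply: (cvg_comp (fun x => a * x) (fun y => expR (- y))).
  by apply: gt0_cvgMry => //; exact: cvg_id.
exact: cvgr_expR.
Qed.

Lemma continuous_expRNM a : continuous (fun x => expR (- (a * x))).
Proof.
move=> x; apply: continuous_comp; last exact: continuous_expR.
by apply: cvgN; apply: mulrl_continuous.
Qed.

Lemma integrable_expRNM a : 0 < a ->
  mu.-integrable `]0, +oo[ (EFin \o (fun x => expR (- (a * x)))).
Proof.
move=> a0.
have c := @continuous_expRNM a.
apply: integrableS (_ : mu.-integrable `[0, +oo[ _) => //.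
  by move=> x /=; rewrite !in_itv/= !andbT => /ltW.
apply/integrableP; split.
  by apply/measurable_EFinP/measurable_funTS; exact: continuous_measurable_fun.
under eq_integral do rewrite /= ger0_norm ?expR_ge0//.
rewrite (@ge0_continuous_FTC2y _ _ (fun x => - (a^-1 * expR (- (a * x)))) _ (- (a^-1 * 0))).
- by rewrite -EFinB ltry.
- by move=> x _; exact: expR_ge0.
- exact: continuous_subspaceT.
- by apply: cvgN; apply: cvgMl_tmp; exact: cvg_expRNM.
- by move=> x _; exact: ex_derive.
- apply: cvg_at_right_filter; apply: cvgN; apply: cvgMl_tmp.
  exact: c.
- move=> x _; rewrite derive1E derive_val /GRing.scale/=.
  field; lra.
Qed.

Lemma measurable_fun_expRNM (D : set R) a :
  measurable_fun D (fun x => expR (- (a * x))).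
Proof.
apply: measurable_funTS; apply: continuous_measurable_fun; exact: continuous_expRNM.
Qed.

Lemma continuous_cosM b : continuous (fun x => cos (b * x)).
Proof.
move=> x; apply: continuous_comp; last exact: continuous_cos.
exact: mulrl_continuous.
Qed.

Lemma continuous_sinM b : continuous (fun x => sin (b * x)).
Proof.
move=> x; apply: continuous_comp; last exact: continuous_sin.
exact: mulrl_continuous.
Qed.

(* The real part of (p + i q) exp(-(a + i b) x). *)
Definition damped a b p q x : R := expR (- (a * x)) * (p * cos (b * x) + q * sin (b * x)).

Lemma continuous_damped a b p q : continuous (damped a b p q).
Proof.
move=> x; apply: cvgM; first exact: continuous_expRNM.
apply: cvgD; apply: cvgMl_tmp; [exact: continuous_cosM|exact: continuous_sinM].
Qed.

Lemma damped_le a b p q x : `|damped a b p q x| <= (`|p| + `|q|) * expR (- (a * x)).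
Proof.
rewrite normrM ger0_norm ?expR_ge0// mulrC ler_wpM2r ?expR_ge0//.
rewrite (le_trans (ler_normD _ _))// !normrM lerD//.
- by rewrite ler_piMr// cos_max.
- by rewrite ler_piMr// sin_max.
Qed.

Lemma integrable_damped a b p q : 0 < a ->
  mu.-integrable `]0, +oo[ (EFin \o damped a b p q).
Proof.
move=> a0; apply: (integrable_le_norm (g := fun x => (`|p| + `|q|) * expR (- (a * x)))) => //.
- by apply: measurable_funTS; apply: continuous_measurable_fun; exact: continuous_damped.
- by apply: (integrableZl _ (`|p| + `|q|) (integrable_expRNM a0)).
- by move=> x _; exact: damped_le.
Qed.

(** Differentiation multiplies the amplitude [p + i q] by [-(a + i b)], so the family [damped a b]
    is closed under it. *)
Lemma is_derive_damped a b p q x :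
  is_derive x 1 (damped a b p q) (damped a b (b * q - a * p) (- (b * p) - a * q) x).
Proof.
rewrite /damped; apply: trigger_derive; rewrite /GRing.scale/=; ring.
Qed.

Lemma cvg_damped a b p q : 0 < a -> damped a b p q x @[x --> +oo] --> (0 : R).
Proof.
move=> a0.
apply: norm_cvg0; apply: (@squeeze_cvgr _ _ _ _ (cst 0) (fun x => (`|p| + `|q|) * expR (- (a * x)))).
- by near=> x; rewrite /= normr_ge0 damped_le.
- exact: cvg_cst.
- by rewrite -[X in _ --> X](mulr0 (`|p| + `|q|)); apply: cvgMl_tmp; exact: cvg_expRNM.
Unshelve. all: by end_near. Qed.

(** The amplitude [P + i Q] of the primitive is [-(p + i q) / (a + i b)], and [N] is the squared
    modulus of [a + i b]. *)
Lemma is_derive_damped_primitive a b p q (N := a ^+ 2 + b ^+ 2)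
    (P := - (p * a + q * b) / N) (Q := (p * b - q * a) / N) x : 0 < a ->
  is_derive x 1 (damped a b P Q) (damped a b p q x).
Proof.
move=> a0; have N0 : a ^+ 2 + b ^+ 2 != 0.
  by rewrite gt_eqF// ltr_pwDl ?exprn_gt0// sqr_ge0.
have -> : damped a b p q x = damped a b (b * Q - a * P) (- (b * P) - a * Q) x.
  by congr damped; rewrite /P /Q /N; field.
exact: is_derive_damped.
Qed.

(** The value is the real part of [(p + i q) / (a + i b)]. *)
Lemma Rintegral_damped a b p q : 0 < a ->
  Rintegral mu `]0, +oo[ (damped a b p q) = (p * a + q * b) / (a ^+ 2 + b ^+ 2).
Proof.
move=> a0; rewrite (Rintegral_FTC2y _ (fun x => is_derive_damped_primitive b p q x a0) (cvg_damped _ _ _ a0))//.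
- by rewrite /damped !mulr0 oppr0 expR0 cos0 sin0; ring.
- exact: continuous_damped.
- exact: integrable_damped.
Qed.

(** With [z = a + i b], the value is the real part of [(p + i q) / z] times [1 - exp(-z r)]. *)
Lemma Rintegral_damped_itv a b p q r : 0 < a -> 0 < r ->
  Rintegral mu `]0, r[ (damped a b p q) = (p * a + q * b) / (a ^+ 2 + b ^+ 2)
   - damped a b (p * a + q * b) (q * a - p * b) r / (a ^+ 2 + b ^+ 2).
Proof.
move=> a0 r0.
rewrite Rintegral_itv_bndo_bndc; last first.
  by apply: integrableS (integrable_damped _ _ _ a0) => //; apply: subset_itvl; rewrite bnd_simp.
rewrite Rintegral_itv_obnd_cbnd; last first.
  by apply: integrableS (integrable_damped _ _ _ a0) => //; apply: subset_itvl; rewrite bnd_simp.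
have dF x := is_derive_damped_primitive b p q x a0.
have cF := continuous_is_derive dF.
rewrite /Rintegral (continuous_FTC2 (F := damped a b (- (p * a + q * b) / (a ^+ 2 + b ^+ 2)) ((p * b - q * a) / (a ^+ 2 + b ^+ 2)))) //.
- by rewrite /= /damped !mulr0 oppr0 expR0 cos0 sin0; ring.
- by apply: continuous_subspaceT; exact: continuous_damped.
- split=> [x _||].
  + exact: (@ex_derive _ _ _ _ _ _ _ (dF x)).
  + exact/cvg_at_right_filter/cF.
  + exact/cvg_at_left_filter/cF.
- by move=> x _; rewrite derive1E; exact: (@derive_val _ _ _ _ _ _ _ (dF x)).
Qed.

End integrals_on_halfline.

(** * The damped sine integral and a dominated Fubini theorem *)

Section damped_sinc.
Context {R : realType}.
Notation mu := (@lebesgue_measure R).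
Implicit Types (f g F : R -> R) (a b r s t x : R).

Lemma normr_sin_le x : `|sin x| <= `|x|.
Proof.
wlog x0 : x / 0 <= x.
  move=> h; have [/h//|/ltW x0] := leP 0 x.
  by rewrite -normrN -sinN -[leRHS]normrN h// oppr_ge0.
have := @MVT_segment R sin cos 0 x x0 (fun y _ => is_derive_sin y).
case=> [|c _]; first by apply: continuous_subspaceT; exact: continuous_sin.
rewrite sin0 !subr0 => ->.
by rewrite normrM ler_piMl// cos_max.
Qed.

Lemma normr_sinc_le r x : `|sin (r * x) / x| <= `|r|.
Proof.
(* Division by zero yields 0, so the quotient vanishes at [x = 0] and the bound holds there too. *)
have [->|x0] := eqVneq x 0; first by rewrite invr0 mulr0 normr0.
by rewrite normrM normfV ler_pdivrMr ?normr_gt0// -normrM normr_sin_le.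
Qed.

Lemma measurable_fun_invr (D : set R) : measurable_fun D (@GRing.inv R).
Proof.
apply: measurable_funTS; rewrite -(setvU [set (0 : R)]).
apply/measurable_funU => //; first exact: measurableC.
split.
  apply: open_continuous_measurable_fun; first by rewrite (_ : ~` _ = [set x : R | x != 0]); [exact: open_neq|apply/seteqP; split=> x /= /eqP].
  by move=> x; rewrite inE /= => /eqP x0; exact: inv_continuous.
exact: measurable_fun_set1.
Qed.

Lemma measurable_sinc (D : set R) r : measurable_fun D (fun x => sin (r * x) / x).
Proof.
apply: measurable_funM; last exact: measurable_fun_invr.
apply: measurable_funTS; apply: continuous_measurable_fun; exact: continuous_sinM.
Qed.

Lemma integrable_damped_sinc a r : 0 < a ->
  mu.-integrable `]0, +oo[ (EFin \o (fun x => expR (- (a * x)) * (sin (r * x) / x))).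
Proof.
move=> a0; apply: (integrable_le_norm (g := fun x => `|r| * expR (- (a * x)))) => //.
- apply: measurable_funM; [exact: measurable_fun_expRNM|exact: measurable_sinc].
- by apply: (integrableZl _ `|r| (integrable_expRNM a0)).
- move=> x _; rewrite normrM mulrC (ger0_norm (expR_ge0 _)) ler_wpM2r ?expR_ge0//.
  exact: normr_sinc_le.
Qed.

(** Differentiating in [s] under the integral removes the denominator [x] and leaves the integral of
    [exp(-a x) cos(s x)], which is [a / (a^2 + s^2)], the derivative of [atan(s / a)]. Both sides
    vanish at [s = 0]. *)
Lemma Rintegral_damped_sinc a s : 0 < a ->
  Rintegral mu `]0, +oo[ (fun x => expR (- (a * x)) * (sin (s * x) / x)) = atan (s / a).
Proof.
move=> a0.
pose f (s x : R) := expR (- (a * x)) * (sin (s * x) / x).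
pose F (s : R) := Rintegral mu `]0, +oo[ (f s).
have df (t x : R) : 0 < x -> is_derive t 1 (f^~ x) (damped a t 1 0 x).
  move=> x0; rewrite /f /damped; apply: trigger_derive; rewrite /GRing.scale/=.
  by field; rewrite gt_eqF.
have p1 t x : 0 < x -> partial1of2 f t x = damped a t 1 0 x.
  by move=> x0; rewrite partial1of2E; exact: (@derive_val _ _ _ _ _ _ _ (df t x x0)).
have intf t : mu.-integrable `]0, +oo[ (EFin \o f t) by exact: integrable_damped_sinc.
(* Differentiation under the integral is local in the parameter; the majorant [exp(-a y)] of the
   derivative is the same around every [t]. *)
have tI t : `]t - 1, t + 1[%classic t by rewrite /= in_itv/= ltrBlDr ltrDl ltr01.
have dfI t (x y : R) : `]t - 1, t + 1[%classic x -> `]0, +oo[%classic y -> derivable (f^~ y) x 1.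
  move=> _; rewrite /= in_itv/= andbT => y0; exact: (@ex_derive _ _ _ _ _ _ _ (df x y y0)).
have ubI t (x y : R) : `]t - 1, t + 1[%classic x -> `]0, +oo[%classic y ->
    `|partial1of2 f x y| <= expR (- (a * y)).
  move=> _; rewrite /= in_itv/= andbT => y0; rewrite p1// (le_trans (damped_le _ _ _ _ _))//.
  by rewrite normr1 normr0 addr0 mul1r.
have dF t : is_derive t 1 F (a / (a ^+ 2 + t ^+ 2)).
  apply: DeriveDef.
    apply: (derivable_under_integral _ (tI t) (fun x _ => intf x) (@dfI t) _ (integrable_expRNM a0) (@ubI t)) => //.
  rewrite -derive1E (differentiation_under_integral _ (tI t) (fun x _ => intf x) (@dfI t) _ (integrable_expRNM a0) (@ubI t)) //.
  transitivity (Rintegral mu `]0, +oo[ (damped a t 1 0)).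
    apply: eq_Rintegral => x; rewrite /=.
    by rewrite inE /= in_itv/= andbT => x0; rewrite p1.
  by rewrite Rintegral_damped// mul1r mul0r addr0.
have dG t : is_derive t 1 (fun s => F s - atan (s / a)) 0.
  have dF' := dF t.
  apply: trigger_derive; rewrite /GRing.scale/=; field.
  by rewrite !gt_eqF//= ltr_pwDl ?exprn_gt0// sqr_ge0.
have := is_derive_0_is_cst s 0 dG.
rewrite mul0r atan0 subr0 => /eqP; rewrite subr_eq => /eqP.
rewrite -/(F s) => ->; rewrite [F 0](_ : _ = 0) ?add0r//.
rewrite /F; under eq_Rintegral do rewrite /f mul0r sin0 mul0r mulr0.
by rewrite Rintegral_cst// mul0r.
Qed.

(** Meant for the exchange after Abel damping, where an exponential dominates in one variable and an
    integrable function in the other. *)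
Lemma Fubini_dominated (D : set R) (f : R -> R -> R) (u v : R -> R) :
    measurable D -> measurable_fun [set: R * R] (fun z => f z.1 z.2) ->
    mu.-integrable D (EFin \o u) -> mu.-integrable D (EFin \o v) ->
    (forall x y, D x -> D y -> `|f x y| <= u x * v y) ->
  Rintegral mu D (fun x => Rintegral mu D (f x)) =
  Rintegral mu D (fun y => Rintegral mu D (f^~ y)).
Proof.
move=> mD mf iu iv fuv.
(* Extension by zero outside the square of [D] reduces to Fubini on the whole plane; [g12] and [g21]
   identify the inner integrals. *)
pose g := (fun z : R * R => (f z.1 z.2)%:E) \_ (D `*` D).
have mDD : measurable (D `*` D) by exact: measurableX.
have mg : measurable_fun setT g.
  apply/(measurable_restrictT _ _).1 => //.
  by apply: measurable_funTS; apply/measurable_EFinP.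
have g12 x : (\int[mu]_y g (x, y))%E = (((fun x => \int[mu]_(y in D) (f x y)%:E) \_ D) x)%E.
  rewrite patchE; case: ifPn => xD.
    rewrite [RHS]integral_mkcond; apply: eq_integral => y _.
    rewrite /g !patchE; congr (if _ then _ else _).
    by apply/idP/idP; rewrite !inE/=; [case|move: xD; rewrite inE].
  rewrite (eq_integral (cst 0%E)) ?integral0// => y _.
  rewrite /g patchE ifF//; apply/negP; rewrite inE/= => -[/mem_set].
  by rewrite (negPf xD).
have g21 y : (\int[mu]_x g (x, y))%E = (((fun y => \int[mu]_(x in D) (f x y)%:E) \_ D) y)%E.
  rewrite patchE; case: ifPn => yD.
    rewrite [RHS]integral_mkcond; apply: eq_integral => x _.
    rewrite /g !patchE; congr (if _ then _ else _).
    by apply/idP/idP; rewrite !inE/=; [case|move: yD; rewrite inE].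
  rewrite (eq_integral (cst 0%E)) ?integral0// => x _.
  rewrite /g patchE ifF//; apply/negP; rewrite inE/= => -[_ /mem_set].
  by rewrite (negPf yD).
have sect1 x : D x -> mu.-integrable D (fun y => (f x y)%:E).
  move=> Dx; apply: (integrable_le_norm (g := fun y => u x * v y)) => //.
  - apply: measurable_funTS.
    exact: (measurableT_comp mf (pair1_measurable x)).
  - exact: (integrableZl _ (u x) iv).
  - by move=> y Dy; exact: fuv.
have sect2 y : D y -> mu.-integrable D (fun x => (f x y)%:E).
  move=> Dy; apply: (integrable_le_norm (g := fun x => v y * u x)) => //.
  - apply: measurable_funTS.
    exact: (measurableT_comp mf (pair2_measurable y)).
  - exact: (integrableZl _ (v y) iu).
  - by move=> x Dx; rewrite mulrC; exact: fuv.
(* It suffices that the iterated integral of [|g|] is finite; it is at most the product of the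
   integrals of [|u|] and [|v|]. *)
have ig : (mu \x mu)%E.-integrable setT g.
  apply/integrable12ltyP => //.
  apply: (@le_lt_trans _ _ (\int[mu]_(x in D) ((`|u x| * Rintegral mu D (fun y => `|v y|))%:E))%E).
    rewrite [leRHS]integral_mkcond; apply: ge0_le_integral => //.
    - by move=> x _; exact: integral_ge0.
    - have mag : measurable_fun setT (abse \o g) by exact: measurableT_comp.
      have h := @measurable_fun_fubini_tonelli_F _ _ _ _ _ mu (abse \o g) mag.
      by apply: h => z; exact: abse_ge0.
    - apply/(measurable_restrictT _ _).1 => //.
      apply/measurable_EFinP; apply: measurable_funM => //.
      by apply: measurableT_comp => //; apply/measurable_EFinP; exact: measurable_int iu.
    - move=> x _; rewrite patchE; case: ifPn => xD; last first.
        rewrite (eq_integral (cst 0%E)) ?integral0// => y _.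
        rewrite /g patchE ifF ?abse0//; apply/negP; rewrite inE/= => -[/mem_set].
        by rewrite (negPf xD).
      have Dx : D x by move: xD; rewrite inE.
      apply: (@le_trans _ _ (\int[mu]_(y in D) ((`|u x| * `|v y|)%:E))%E).
        rewrite [leRHS]integral_mkcond; apply: ge0_le_integral => //.
        + by apply: measurableT_comp => //; exact: (measurableT_comp mg (pair1_measurable x)).
        + apply/(measurable_restrictT _ _).1 => //.
          apply/measurable_EFinP; apply: measurable_funM => //.
          by apply: measurableT_comp => //; apply/measurable_EFinP; exact: measurable_int iv.
        + move=> y _; rewrite /g !patchE; case: ifPn.
            rewrite inE/= => -[_ Dy]; rewrite mem_set//= lee_fin.
            by rewrite (le_trans (fuv _ _ Dx Dy))// -normrM ler_norm.
          by rewrite abse0; case: ifPn => // _; rewrite lee_fin mulr_ge0.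
      rewrite EFinM /Rintegral fineK; last first.
        by apply: integrable_fin_num => //; exact: integrable_norm.
      rewrite -ge0_integralZl//.
      by apply/measurable_EFinP; apply: measurableT_comp => //; apply/measurable_EFinP; exact: measurable_int iv.
  apply: integrable_lty => //.
  have h := integrableZl _ (Rintegral mu D (fun y => `|v y|)) (integrable_norm iu).
  by under eq_fun do rewrite mulrC EFinM; exact: h.
have FE := Fubini ig.
have E1 : Rintegral mu D (fun x => Rintegral mu D (f x)) = fine (\int[mu]_x \int[mu]_y g (x, y)).
  rewrite {1}/Rintegral integral_mkcond; congr fine; apply: eq_integral => x _.
  rewrite g12 !patchE; case: ifPn => // /set_mem Dx.
  by rewrite /Rintegral fineK//; exact: integrable_fin_num (sect1 _ Dx).
have E2 : Rintegral mu D (fun y => Rintegral mu D (f^~ y)) = fine (\int[mu]_y \int[mu]_x g (x, y)).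
  rewrite {1}/Rintegral integral_mkcond; congr fine; apply: eq_integral => y _.
  rewrite g21 !patchE; case: ifPn => // /set_mem Dy.
  by rewrite /Rintegral fineK//; exact: integrable_fin_num (sect2 _ Dy).
by rewrite E1 E2 FE.
Qed.

End damped_sinc.

(** * The sine integral of a cosine transform *)

Section cosine_transform.
Context {R : realType}.
Notation mu := (@lebesgue_measure R).
Implicit Types (f g F : R -> R) (a b r s t x : R).

(** As the scale grows, the arctangent tends to a step function; for [s = r - t] its jump produces
    the cutoff at [t = r] in the sine integral. *)
Lemma cvg_atan_scale s : atan (s * n.+1%:R) @[n --> \oo] --> pi / 2 * Num.sg s.
Proof.
have cy : (n.+1%:R : R) @[n --> \oo] --> +oo.
  apply/cvgryPge => A; near=> n.
  rewrite (@le_trans _ _ n%:R) ?ler_nat//.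
  by near: n; exact: nbhs_infty_ger.
have pos t : 0 < t -> atan (t * n.+1%:R) @[n --> \oo] --> pi / 2.
  move=> t0; apply: (cvg_comp (fun n => n.+1%:R) (fun x => atan (t * x)) cy).
  apply: (cvg_comp (fun x => t * x) (@atan R) _ (@cvgy_atan R)).
  by apply: gt0_cvgMry => //; exact: cvg_id.
have [s0|s0|->] := ltgtP s 0.
- rewrite ltr0_sg// mulrN1.
  rewrite (_ : (fun n => _) = (fun n => - atan (- s * n.+1%:R))); last first.
    by apply/funext => n; rewrite mulNr atanN opprK.
  by apply: cvgN; apply: pos; rewrite oppr_gt0.
- by rewrite gtr0_sg// mulr1; exact: pos.
- rewrite sgr0 mulr0; under eq_fun do rewrite mul0r atan0.
  exact: cvg_cst.
Unshelve. all: by end_near. Qed.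

Lemma atan_le x : `|atan x| <= pi / 2.
Proof. by rewrite ler_norml ltW ?atan_gtNpi2// ltW// atan_ltpi2. Qed.

Definition cos_transform (w : R -> R) (k : R) : R :=
  Rintegral mu `]0, +oo[ (fun t => w t * cos (k * t)).

(* Abel regularization: inserting exp(-k/n) makes the double integral absolutely convergent,
   and the inner k-integral becomes a half sum of arctangents, uniformly bounded in n and
   tending to (pi/2) times the indicator of t < r *)
Lemma Rintegral_sinc_cos_transform (w : R -> R) r : 0 < r ->
    measurable_fun setT w -> mu.-integrable `]0, +oo[ (EFin \o w) ->
    mu.-integrable `]0, +oo[ (EFin \o (fun k => sin (r * k) / k * cos_transform w k)) ->
  Rintegral mu `]0, +oo[ (fun k => sin (r * k) / k * cos_transform w k) =
  pi / 2 * Rintegral mu `]0, r[ w.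
Proof.
move=> r0 mw iw iJ.
pose D : set R := `]0, +oo[%classic; have mD : measurable (D : set (measurableTypeR R)) by exact: measurable_itv.
pose e (n : nat) : R := n.+1%:R^-1.
have e0 n : 0 < e n by rewrite invr_gt0 ltr0n.
pose J n := Rintegral mu D (fun k => expR (- (e n * k)) * (sin (r * k) / k * cos_transform w k)).
have expR_le1 n k : D k -> expR (- (e n * k)) <= 1.
  by rewrite /D/= in_itv/= andbT => k0; rewrite -expR0 ler_expR oppr_le0 mulr_ge0 ?ltW.
have mJ : measurable_fun D (fun k => sin (r * k) / k * cos_transform w k).
  by apply/measurable_EFinP; exact: measurable_int iJ.
have lim1 : J n @[n --> \oo] --> Rintegral mu D (fun k => sin (r * k) / k * cos_transform w k).
  apply: (dominated_cvg_Rintegral (g := fun k => `|sin (r * k) / k * cos_transform w k|)) => //.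
  - by move=> n; apply: measurable_funM => //; exact: measurable_fun_expRNM.
  - move=> k _; rewrite -[X in _ --> X]mul1r; apply: cvgM; last exact: cvg_cst.
    rewrite -(@expR0 R); apply: (cvg_comp (fun n => - (e n * k)) expR); last exact: continuous_expR.
    rewrite -oppr0; apply: cvgN; rewrite -(mul0r k); apply: cvgM; last exact: cvg_cst.
    exact: cvg_harmonic.
  - exact: integrable_norm.
  - move=> n k Dk; rewrite normrM ler_piMl// ger0_norm ?expR_ge0//.
    exact: expR_le1.
(* From [sin(r k) cos(k t) = (sin((r + t) k) + sin((r - t) k)) / 2], each damped sine integral being
   an arctangent; the factor [n.+1] is the inverse of [e n]. *)
pose S n t : R := (atan ((r + t) * n.+1%:R) + atan ((r - t) * n.+1%:R)) / 2.
have icos k : mu.-integrable D (EFin \o (fun t => w t * cos (k * t))).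
  apply: (integrable_le_norm (g := fun t => `|w t|)) => //.
  - apply: measurable_funM; first exact: measurable_funTS.
    by apply: measurable_funTS; apply: continuous_measurable_fun; exact: continuous_cosM.
  - exact: integrable_norm.
  - by move=> t _; rewrite normrM ler_piMr// cos_max.
have JE n : J n = Rintegral mu D (fun t => w t * S n t).
  pose f k t := expR (- (e n * k)) * (sin (r * k) / k) * (w t * cos (k * t)).
  transitivity (Rintegral mu D (fun k => Rintegral mu D (f k))).
    apply: eq_Rintegral => k _; rewrite /f; rewrite (RintegralZl _ mD (icos k)).
    by rewrite mulrA.
  rewrite (@Fubini_dominated _ D f (fun k => r * expR (- (e n * k))) (fun t => `|w t|))//.
  - apply: eq_Rintegral => t _.
    pose h s k := expR (- (e n * k)) * (sin (s * k) / k).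
    transitivity (Rintegral mu D (fun k => w t / 2 * (h (r + t) k + h (r - t) k))).
      apply: eq_Rintegral => k _; rewrite /f /h !mulrDl mulNr sinD sinB [k * t]mulrC.
      (* Abstracting [k^-1] frees [field] from the side condition [k != 0]. *)
      by move: k^-1 => ki; field.
    have ih s : mu.-integrable D (EFin \o h s) by exact: integrable_damped_sinc.
    rewrite RintegralZl//; last exact: (integrableD _ (ih _) (ih _)).
    rewrite RintegralD// !Rintegral_damped_sinc// /S /e !invrK.
    by rewrite mulrAC mulrA.
  - rewrite /f; apply: measurable_funM.
      apply: (measurableT_comp (f := fun k => expR (- (e n * k)) * (sin (r * k) / k))).
        by apply: measurable_funM; [exact: measurable_fun_expRNM|exact: measurable_sinc].
      exact: measurable_fst.
    apply: measurable_funM; first exact: (measurableT_comp mw).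
    apply: (measurableT_comp (f := cos)); first exact: continuous_measurable_fun (@continuous_cos R).
    by apply: measurable_funM; [exact: measurable_fst|exact: measurable_snd].
  - by apply: (integrableZl _ r (integrable_expRNM _)).
  - exact: integrable_norm.
  - move=> k t _ _; rewrite /f normrM ler_pM// normrM.
      rewrite mulrC (ger0_norm (expR_ge0 _)) ler_wpM2r ?expR_ge0//.
      by rewrite (le_trans (normr_sinc_le _ _))// gtr0_norm.
    by rewrite ler_piMr// cos_max.
(* The pointwise limit of [S] for [t > 0]: [pi / 2] if [t < r], [pi / 4] at [t = r] and 0 if
   [t > r]. *)
pose L t : R := pi / 4 * (1 + Num.sg (r - t)).
have S_le n t : `|S n t| <= pi / 2.
  rewrite normrM (ger0_norm (_ : 0 <= 2^-1)) ?invr_ge0// ler_pdivrMr//.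
  by rewrite (le_trans (ler_normD _ _))// (_ : pi / 2 * 2 = pi / 2 + pi / 2 :> R) ?lerD ?atan_le//; field.
have mwS n : measurable_fun D (fun t => w t * S n t).
  apply: measurable_funM; first exact: measurable_funTS.
  apply: measurable_funTS; apply: continuous_measurable_fun => t.
  apply: cvgMr_tmp; apply: cvgD.
    apply: continuous_comp; last exact: continuous_atan.
    by apply: cvgMr_tmp; apply: cvgD; [exact: cvg_cst|exact: cvg_id].
  apply: continuous_comp; last exact: continuous_atan.
  by apply: cvgMr_tmp; apply: cvgB; [exact: cvg_cst|exact: cvg_id].
have cwS t : D t -> w t * S n t @[n --> \oo] --> w t * L t.
  rewrite /D/= in_itv/= andbT => t0.
  apply: cvgM; first exact: cvg_cst.
  rewrite /L (_ : pi / 4 * _ = (pi / 2 * Num.sg (r + t) + pi / 2 * Num.sg (r - t)) / 2).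
    apply: cvgM; last exact: cvg_cst.
    by apply: cvgD; exact: cvg_atan_scale.
  by rewrite (gtr0_sg (addr_gt0 r0 t0)); field.
have mwL : measurable_fun D (fun t => w t * L t) by exact: measurable_fun_cvg mwS cwS.
have lim2 : J n @[n --> \oo] --> Rintegral mu D (fun t => w t * L t).
  under eq_fun do rewrite JE.
  apply: (dominated_cvg_Rintegral (g := fun t => pi / 2 * `|w t|)) => //.
  - exact: (integrableZl _ (pi / 2) (integrable_norm iw)).
  - move=> n t _; rewrite normrM mulrC.
    by rewrite ler_wpM2r// S_le.
(* Both limits of [J] agree; splitting the second one at [r] leaves only []0, r[], where [L] is
   [pi / 2]. *)
rewrite -/D -(cvg_lim _ lim1)// (cvg_lim _ lim2)//.
have Dr : D = `]0, r] `|` `]r, +oo[ by rewrite /D; apply: itv_bndbnd_setU; rewrite bnd_simp// ltW.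
have wL1 : {in `]0, r[%classic, (fun t => w t * L t) =1 (fun t => pi / 2 * w t)}.
  move=> t; rewrite inE/= in_itv/= => /andP[_ tr].
  by rewrite /L gtr0_sg ?subr_gt0//; field.
have wL2 : {in `]r, +oo[%classic, (fun t => w t * L t) =1 (fun t => 0)}.
  move=> t; rewrite inE/= in_itv/= andbT => tr.
  by rewrite /L ltr0_sg ?subr_lt0// subrr !mulr0.
have iwL : mu.-integrable D (EFin \o (fun t => w t * L t)).
  apply: (integrable_le_norm (g := fun t => pi / 2 * `|w t|)) => //.
  - exact: (integrableZl _ (pi / 2) (integrable_norm iw)).
  - move=> t _; rewrite normrM mulrC ler_wpM2r// /L normrM (ger0_norm (_ : 0 <= pi / 4)) ?divr_ge0 ?pi_ge0//.
    rewrite (_ : pi / 2 = pi / 4 * 2 :> R); last by field.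
    rewrite ler_wpM2l ?divr_ge0 ?pi_ge0// (le_trans (ler_normD _ _))// normr1 normr_sg.
    by case: eqP => _ /=; lra.
rewrite Dr Rintegral_setU//; last 2 first.
- by rewrite -Dr.
- apply/disj_setPS => t [] /=; rewrite !in_itv/= andbT => /andP[_ tr] rt.
  by have := le_lt_trans tr rt; rewrite ltxx.
have -> : Rintegral mu `]r, +oo[ (fun t => w t * L t) = 0.
  transitivity (Rintegral mu `]r, +oo[ (fun=> 0)); first exact: eq_Rintegral.
  by rewrite Rintegral_cst// mul0r.
rewrite addr0 -Rintegral_itv_bndo_bndc; last first.
  by apply: integrableS iwL => //; apply: subset_itvl; rewrite bnd_simp.
transitivity (Rintegral mu `]0, r[ (fun t => pi / 2 * w t)); first exact: eq_Rintegral.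
rewrite RintegralZl//.
by apply: integrableS iw => //; apply: subset_itvl; rewrite bnd_simp.
Qed.

End cosine_transform.

(** * Cauchy kernels *)

Section kernels.
Context {R : realType}.
Notation mu := (@lebesgue_measure R).
Implicit Types (h : R -> R) (a b p q k r s t x : R) (d m z : R[i]).

(** The complex weight [d] will be a residue times [m], or ['i] times that; the second choice gives
    access to imaginary parts. *)
Definition cauchy_kernel d m k : R := complex.Re (d * m / (m ^+ 2 + (k ^+ 2)%:C)).

Lemma ReM_expC d m t : complex.Re (d * expC (- (t%:C * m))) =
  damped (complex.Re m) (complex.Im m) (complex.Re d) (complex.Im d) t.
Proof.
case: d m => [p q] [a b]; rewrite /expC /damped /=.
rewrite !mul0r subr0 addr0 cosN sinN [t * a]mulrC [t * b]mulrC; ring.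
Qed.

Lemma Re_mulr z (c : R) : complex.Re (z * c%:C) = complex.Re z * c.
Proof. by case: z => u v /=; ring. Qed.

Lemma ReD z1 z2 : complex.Re (z1 + z2) = complex.Re z1 + complex.Re z2.
Proof. by case: z1 z2 => [? ?] [? ?]. Qed.

Lemma ReB z1 z2 : complex.Re (z1 - z2) = complex.Re z1 - complex.Re z2.
Proof. by case: z1 z2 => [? ?] [? ?]. Qed.

Lemma Re_div p q a c : complex.Re ((p +i* q) / (a +i* c)) = (p * a + q * c) / (a ^+ 2 + c ^+ 2).
Proof. by rewrite /=; ring. Qed.

Lemma Im_div p q a c : complex.Im ((p +i* q) / (a +i* c)) = (q * a - p * c) / (a ^+ 2 + c ^+ 2).
Proof. by rewrite /=; ring. Qed.

(** Partial fractions in [k]: [d m / (m^2 + k^2)] is half the sum of [d / (m + i k)] and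
    [d / (m - i k)], with [m + i k = a + i (b + k)] and likewise for the other sign. *)
Lemma cauchy_kernelE d m k (a := complex.Re m) (b := complex.Im m)
    (p := complex.Re d) (q := complex.Im d) : 0 < complex.Re m ->
  cauchy_kernel d m k =
  ((p * a + q * (b + k)) / (a ^+ 2 + (b + k) ^+ 2) +
   (p * a + q * (b - k)) / (a ^+ 2 + (b - k) ^+ 2)) / 2.
Proof.
move=> m0; rewrite -!Re_div.
have nz c : a +i* c != 0 by rewrite eq_complex /= negb_and gt_eqF.
have mE : m ^+ 2 + (k ^+ 2)%:C = (a +i* (b + k)) * (a +i* (b - k)).
  rewrite /a /b; case: (m) => u v; apply/eqP; rewrite eq_complex /=.
  by apply/andP; split; apply/eqP; ring.
have -> : cauchy_kernel d m k = complex.Re (((p +i* q) / (a +i* (b + k)) + (p +i* q) / (a +i* (b - k))) * (2^-1)%:C).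
  rewrite /cauchy_kernel mE; congr (complex.Re _).
  have -> : d = p +i* q by rewrite /p /q; case: (d).
  have -> : m = ((a +i* (b + k)) + (a +i* (b - k))) * (2^-1)%:C.
    rewrite /a /b; case: (m) => u v; apply/eqP; rewrite eq_complex /=.
    by apply/andP; split; apply/eqP; field.
  rewrite fmorphV rmorph_nat; field.
  by rewrite !nz.
by rewrite Re_mulr ReD.
Qed.

(** Multiplication by [cos(k t)] shifts the frequency [b] to [b + k] and [b - k] with weight one
    half each; the two integrals are the two terms of [cauchy_kernelE]. *)
Lemma cauchy_kernel_cos_transform d m k : 0 < complex.Re m ->
  cos_transform (damped (complex.Re m) (complex.Im m) (complex.Re d) (complex.Im d)) k =
  cauchy_kernel d m k.
Proof.
move=> m0; rewrite cauchy_kernelE//.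
set a := complex.Re m; set b := complex.Im m; set p := complex.Re d; set q := complex.Im d.
transitivity (Rintegral mu `]0, +oo[ (fun t => 2^-1 * (damped a (b + k) p q t + damped a (b - k) p q t))).
  apply: eq_Rintegral => t _.
  by rewrite /damped !mulrDl mulNr cosD cosB sinD sinB; field.
have id s : mu.-integrable `]0, +oo[ (EFin \o damped a s p q) by exact: integrable_damped.
rewrite RintegralZl//; last exact: (integrableD _ (id _) (id _)).
by rewrite RintegralD// !Rintegral_damped// mulrC.
Qed.

(** This rests on [k^2 <= 2 (b + k)^2 + 2 b^2], whose defect is [(2 b + k)^2]; the quotient by [a^2]
    absorbs [1 + 2 b^2]. *)
Lemma sqrD_ge a b k : 0 < a ->
  1 + k ^+ 2 <= ((1 + 2 * b ^+ 2) / a ^+ 2 + 2) * (a ^+ 2 + (b + k) ^+ 2).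
Proof.
move=> a0; rewrite mulrDl mulrDr divfK ?gt_eqF ?exprn_gt0//.
have : 0 <= (1 + 2 * b ^+ 2) / a ^+ 2 * (b + k) ^+ 2.
  by rewrite mulr_ge0 ?divr_ge0 ?sqr_ge0// addr_ge0// mulr_ge0// sqr_ge0.
by have := sqr_ge0 a; have := sqr_ge0 (2 * b + k); nra.
Qed.

(** Over the common denominator [X Y] the numerator is [O(1 + k^2)], while [X] and [Y] are each at
    least [(1 + k^2) / K]; hence the constant with [K ^+ 2]. *)
Lemma cauchy_kernel_bound d m : 0 < complex.Re m ->
  exists C, forall k, `|cauchy_kernel d m k| <= C / (1 + k ^+ 2).
Proof.
move=> m0; set a := complex.Re m; set b := complex.Im m.
set p := complex.Re d; set q := complex.Im d.
pose K := (1 + 2 * b ^+ 2) / a ^+ 2 + 2.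
have K0 : 0 < K by rewrite ltr_wpDl// divr_ge0 ?sqr_ge0// addr_ge0// mulr_ge0// sqr_ge0.
exists ((`|p| * a + `|q| * `|b|) * (1 + a ^+ 2 + b ^+ 2) * K ^+ 2) => k.
rewrite cauchy_kernelE// -/a -/b -/p -/q.
set X := a ^+ 2 + (b + k) ^+ 2; set Y := a ^+ 2 + (b - k) ^+ 2.
have X0 : 0 < X by rewrite ltr_pwDl ?exprn_gt0// sqr_ge0.
have Y0 : 0 < Y by rewrite ltr_pwDl ?exprn_gt0// sqr_ge0.
have -> : ((p * a + q * (b + k)) / X + (p * a + q * (b - k)) / Y) / 2 =
    (p * a * (a ^+ 2 + b ^+ 2 + k ^+ 2) + q * b * (a ^+ 2 + b ^+ 2 - k ^+ 2)) / (X * Y).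
  by rewrite /X /Y; field; rewrite -/X -/Y !gt_eqF.
have k1 : 0 < 1 + k ^+ 2 by rewrite ltr_pwDl// sqr_ge0.
have XK : 1 + k ^+ 2 <= K * X by exact: sqrD_ge.
have YK : 1 + k ^+ 2 <= K * Y by rewrite -[k ^+ 2]sqrrN; exact: sqrD_ge.
rewrite normrM normfV (gtr0_norm (mulr_gt0 X0 Y0)) ler_pdivrMr ?mulr_gt0//.
rewrite [leRHS]mulrAC ler_pdivlMr//.
set A := `|p| * a + `|q| * `|b|.
have A0 : 0 <= A by rewrite addr_ge0// mulr_ge0// ltW.
have num : `|p * a * (a ^+ 2 + b ^+ 2 + k ^+ 2) + q * b * (a ^+ 2 + b ^+ 2 - k ^+ 2)| <=
    A * ((1 + a ^+ 2 + b ^+ 2) * (1 + k ^+ 2)).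
  have Z1 : a ^+ 2 + b ^+ 2 + k ^+ 2 <= (1 + a ^+ 2 + b ^+ 2) * (1 + k ^+ 2).
    by have := mulr_ge0 (addr_ge0 (sqr_ge0 a) (sqr_ge0 b)) (sqr_ge0 k); nra.
  have Z2 : `|a ^+ 2 + b ^+ 2 - k ^+ 2| <= a ^+ 2 + b ^+ 2 + k ^+ 2.
    by rewrite ler_norml; have := sqr_ge0 a; have := sqr_ge0 b; have := sqr_ge0 k => *; apply/andP; split; lra.
  have Z0 : 0 <= a ^+ 2 + b ^+ 2 + k ^+ 2 by rewrite !addr_ge0 ?sqr_ge0.
  rewrite (le_trans (ler_normD _ _))// !normrM (gtr0_norm m0) (ger0_norm Z0) mulrDl lerD//.
    by rewrite ler_wpM2l// mulr_ge0// ltW.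
  by rewrite ler_wpM2l ?mulr_ge0// (le_trans Z2).
apply: (le_trans (ler_wpM2r (ltW k1) num)).
rewrite -!mulrA; apply: ler_wpM2l => //.
apply: ler_wpM2l; first by rewrite !addr_ge0 ?sqr_ge0.
have := ler_pM (ltW k1) (ltW k1) XK YK.
by rewrite expr2 -!mulrA [X * (K * Y)]mulrCA.
Qed.

Lemma measurable_cauchy_kernel d m : 0 < complex.Re m ->
  measurable_fun setT (cauchy_kernel d m).
Proof.
move=> m0.
pose g (c : R) := (complex.Re d * complex.Re m + complex.Im d * c) / (complex.Re m ^+ 2 + c ^+ 2).
have mg : measurable_fun setT g.
  apply: measurable_funM; first by apply: measurable_funD => //; exact: measurable_funM.
  apply: measurableT_comp; first exact: measurable_fun_invr.
  by apply: measurable_funD => //; exact: measurable_funX.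
rewrite (_ : cauchy_kernel d m = (fun k => (g (complex.Im m + k) + g (complex.Im m - k)) / 2)); last first.
  by apply/funext => k; rewrite cauchy_kernelE.
apply: measurable_funM => //; apply: measurable_funD; apply: (measurableT_comp mg).
- exact: measurable_funD.
- exact: measurable_funB.
Qed.

(* L is only constrained on r > 0; h is even, so sin(rk)/k h(k) integrates to pi L(r) over R. *)
Definition sinc_transform (h L : R -> R) : Prop :=
  [/\ measurable_fun setT h, forall k, h (- k) = h k,
      exists C, forall k, `|h k| <= C / (1 + k ^+ 2)
    & forall r, 0 < r ->
        Rintegral mu `]0, +oo[ (fun k => sin (r * k) / k * h k) = pi / 2 * L r].

Lemma integrable_oneDsqrV :
  mu.-integrable setT (EFin \o (fun k => (1 + k ^+ 2)^-1)).
Proof.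
have c : continuous (fun k : R => (1 + k ^+ 2)^-1) by exact: continuous_oneDsqrV.
have ge0 (k : R) : 0 <= (1 + k ^+ 2)^-1 by rewrite invr_ge0 addr_ge0// sqr_ge0.
apply/integrableP; split.
  by apply/measurable_EFinP; exact: continuous_measurable_fun.
under eq_integral do rewrite /= ger0_norm//.
rewrite ge0_symfun_integralT//; last by move=> k; rewrite /= sqrrN.
by rewrite -set_itvcy (@integral0y_oneDsqr R) -EFinM ltry.
Qed.

Lemma integrable_lorentzian_bound (D : set R) (f : R -> R) C :
    measurable (D : set (measurableTypeR R)) -> measurable_fun D f ->
    (forall k, D k -> `|f k| <= C / (1 + k ^+ 2)) ->
  mu.-integrable D (EFin \o f).
Proof.
move=> mD mf fC; apply: (integrable_le_norm (g := fun k => C / (1 + k ^+ 2))) => //.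
have h := integrableS measurableT mD (@subsetT _ D) integrable_oneDsqrV.
exact: (integrableZl mD C h).
Qed.

Lemma integrable_sinc_mul h C r :
    measurable_fun setT h -> (forall k, `|h k| <= C / (1 + k ^+ 2)) ->
  mu.-integrable `]0, +oo[ (EFin \o (fun k => sin (r * k) / k * h k)).
Proof.
move=> mh hC; apply: (@integrable_lorentzian_bound _ _ (`|r| * C)).
- exact: measurable_itv.
- by apply: measurable_funM; [exact: measurable_sinc|exact: measurable_funTS].
- by move=> k _; rewrite normrM -mulrA ler_pM// normr_sinc_le.
Qed.

(** The kernel is the cosine transform of [w], the real part of [d exp(-m t)], and the limit
    function is the integral of [w] over []0, r[]. *)
Lemma sinc_transform_cauchy_kernel d m : 0 < complex.Re m ->
  sinc_transform (cauchy_kernel d m)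
    (fun r => complex.Re (d / m * (1 - expC (- (r%:C * m))))).
Proof.
move=> m0; have [C hC] := cauchy_kernel_bound d m0.
have mk := measurable_cauchy_kernel d m0.
split=> //; first by move=> k; rewrite /cauchy_kernel sqrrN.
  by exists C.
move=> r r0.
set w := damped (complex.Re m) (complex.Im m) (complex.Re d) (complex.Im d).
have wE : cauchy_kernel d m = cos_transform w.
  by apply/funext => k; rewrite cauchy_kernel_cos_transform.
have i := integrable_sinc_mul r mk hC.
rewrite wE Rintegral_sinc_cos_transform//; last 3 first.
- by apply: continuous_measurable_fun; exact: continuous_damped.
- exact: integrable_damped.
- by rewrite -wE.
rewrite Rintegral_damped_itv//; congr (_ * _).
rewrite [in RHS]mulrBr mulr1 ReB ReM_expC; congr (_ - _).
  by case: (d) (m) => [p q] [a b]; rewrite Re_div.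
case: (d) (m) => [p q] [a b]; rewrite Re_div Im_div /damped /=; ring.
Qed.

Lemma sinc_transformD h1 h2 L1 L2 :
    sinc_transform h1 L1 -> sinc_transform h2 L2 ->
  sinc_transform (h1 \+ h2) (L1 \+ L2).
Proof.
move=> [mh1 e1 [C1 hC1] I1] [mh2 e2 [C2 hC2] I2]; split.
- exact: measurable_funD.
- by move=> k /=; rewrite e1 e2.
- by exists (C1 + C2) => k; rewrite /= mulrDl (le_trans (ler_normD _ _))// lerD.
- move=> r r0; rewrite /= mulrDr -I1// -I2// -RintegralD//; last 2 first.
  + exact: integrable_sinc_mul mh1 hC1.
  + exact: integrable_sinc_mul mh2 hC2.
  by apply: eq_Rintegral => k _; rewrite mulrDr.
Qed.

Lemma sinc_transformZ h L (c : R) :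
  sinc_transform h L -> sinc_transform (fun k => c * h k) (fun r => c * L r).
Proof.
move=> [mh e [C hC] I]; split.
- exact: measurable_funM.
- by move=> k /=; rewrite e.
- by exists (`|c| * C) => k; rewrite /= normrM -mulrA ler_wpM2l.
- move=> r r0; rewrite mulrCA -I// -RintegralZl//; last exact: integrable_sinc_mul mh hC.
  by apply: eq_Rintegral => k _; rewrite mulrCA.
Qed.

Lemma sinc_transform_sum n (h L : 'I_n -> R -> R) :
    (forall i, sinc_transform (h i) (L i)) ->
  sinc_transform (fun k => \sum_i h i k) (fun r => \sum_i L i r).
Proof.
elim: n h L => [|n IH] h L hL.
  split.
  - rewrite (_ : (fun k => _) = cst 0); first exact: measurable_cst.
    by apply/funext => k; rewrite big_ord0.
  - by move=> k; rewrite !big_ord0.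
  - by exists 0 => k; rewrite big_ord0 normr0 mul0r.
  - move=> r r0; rewrite big_ord0 mulr0.
    transitivity (Rintegral mu `]0, +oo[ (fun=> 0)).
      by apply: eq_Rintegral => k _; rewrite big_ord0 mulr0.
    by rewrite Rintegral_cst// mul0r.
under eq_fun do rewrite big_ord_recl; under [X in sinc_transform _ X]eq_fun do rewrite big_ord_recl.
exact: sinc_transformD (hL ord0) (IH _ _ (fun i => hL (lift ord0 i))).
Qed.

End kernels.

(** * Partial fractions *)

(** The difference of the two sides is a polynomial in [x] of degree below [n] that vanishes at the
    [n] distinct points [a i]. *)
Lemma lagrange_sum1 (K : fieldType) n (a : 'I_n -> K) (x : K) : (0 < n)%N -> injective a ->
  \sum_j \prod_(l | l != j) ((a l - x) / (a l - a j)) = 1.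
Proof.
move=> n0 inja.
pose P : {poly K} := \sum_j \prod_(l | l != j) ((a l - a j)^-1 *: ((a l)%:P - 'X)) - 1.
have szP : (size P <= n)%N.
  rewrite (leq_trans (size_polyD _ _))// geq_max size_polyN size_poly1 n0 andbT.
  apply: (leq_trans (size_sum _ _ _)); apply/bigmax_leqP => j _.
  apply: (leq_trans (size_poly_prod_leq _ _)).
  rewrite leq_subLR.
  have : (\sum_(l | l != j) size ((a l - a j)^-1 *: ((a l)%:P - 'X)) <= \sum_(l < n | l != j) 2)%N.
    apply: leq_sum => l _; apply: leq_trans (size_scale_leq _ _) _.
    by rewrite -opprB size_polyN size_XsubC.
  (* Each product has [n - 1] factors of size at most 2, hence size at most
     [2 (n - 1) + 1 - (n - 1) = n]. *)
  rewrite sum_nat_const (_ : #|_| = n.-1); last by rewrite cardC1 card_ord.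
  by move=> /leq_ltn_trans; apply; move: n0; lia.
have PE y : P.[y] = \sum_j \prod_(l | l != j) ((a l - y) / (a l - a j)) - 1.
  rewrite /P hornerD hornerN hornerC horner_sum; congr (_ - _).
  apply: eq_bigr => j _; rewrite horner_prod; apply: eq_bigr => l _.
  by rewrite !hornerE mulrC.
have rootP i : root P (a i).
  rewrite /root PE (bigD1 i)//= [X in _ + X - 1]big1 ?addr0.
    rewrite big1 ?subrr// => l li; rewrite divff// subr_eq0.
    by apply: contra_neq li => /inja.
  move=> j ji; rewrite (bigD1 i) 1?eq_sym//= subrr mul0r mul0r//.
have P0 : P = 0.
  apply/eqP; apply: contraTT szP => P0.
  rewrite -ltnNge.
  have := @max_poly_roots _ P [seq a i | i <- enum 'I_n] P0.
  rewrite size_map size_enum_ord; apply.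
    by apply/allP => _ /mapP[i _ ->].
  by rewrite map_inj_uniq ?enum_uniq.
by have /eqP := PE x; rewrite P0 horner0 eq_sym subr_eq0 => /eqP.
Qed.

Section masses.
Context {R : realType}.
Implicit Types (Q : {poly R}) (k x r : R).

(** If the [m j ^+ 2] are the roots of [Q], all simple, and [Q(0) = 1], this is the residue of
    [1 / Q] at [m i ^+ 2] divided by [- m i ^+ 2]. *)
Definition residue n (m : 'I_n -> R[i]) (i : 'I_n) : R[i] :=
  \prod_(j < n | j != i) (m j ^+ 2 / (m j ^+ 2 - m i ^+ 2)).

Lemma mass_neq0 (z : R[i]) : 0 < complex.Re z -> z != 0.
Proof. by move=> z0; rewrite eq_complex negb_and gt_eqF. Qed.

(** The factors [z + i k] and [z - i k] keep the positive real part of [z]. *)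
Lemma sqr_mass_add_neq0 (z : R[i]) k : 0 < complex.Re z -> z ^+ 2 + (k ^+ 2)%:C != 0.
Proof.
move=> z0.
have -> : z ^+ 2 + (k ^+ 2)%:C = (z + k *i) * (z - k *i).
  case: z {z0} => u v; apply/eqP; rewrite eq_complex /=.
  by apply/andP; split; apply/eqP; ring.
by rewrite mulf_neq0// mass_neq0//; case: z z0 => u v /=; rewrite ?subr0 ?oppr0 ?addr0.
Qed.

(** The Lagrange identity at [x = 0]; it makes the constant terms of the transforms add up to 1. *)
Lemma sum_residue n (m : 'I_n -> R[i]) : (0 < n)%N -> injective (fun i => m i ^+ 2) ->
  \sum_i residue m i = 1.
Proof.
move=> n0 inj; rewrite -(lagrange_sum1 0 n0 inj).
by apply: eq_bigr => i _; apply: eq_bigr => j _; rewrite subr0.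
Qed.

(** The [n] distinct values [m i ^+ 2] exhaust the roots of a polynomial of degree [n], so [Q]
    splits; [Q(0) = 1] fixes the leading coefficient. *)
Lemma horner_masses Q n (m : 'I_n -> R[i]) (z : R[i]) :
    size Q = n.+1 -> Q.[0] = 1 -> masses_of Q m ->
  (toC Q).[z] = \prod_i ((m i ^+ 2 - z) / m i ^+ 2).
Proof.
move=> szQ Q01 [mpos inj roots].
pose rs := [seq m i ^+ 2 | i <- enum 'I_n].
have QE : toC Q = lead_coef (toC Q) *: \prod_(y <- rs) ('X - y%:P).
  apply: all_roots_prod_XsubC.
  - by rewrite size_map_poly szQ size_map size_enum_ord.
  - by apply/allP => _ /mapP[i _ ->]; apply/roots; exists i.
  - by rewrite uniq_rootsE map_inj_uniq ?enum_uniq.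
have HE y : (toC Q).[y] = lead_coef (toC Q) * (-1) ^+ n * \prod_i (m i ^+ 2 - y).
  rewrite {1}QE hornerZ horner_prod big_map big_enum/= -mulrA; congr (_ * _).
  rewrite -[n in (-1) ^+ n]card_ord -prodr_const -big_split/=; apply: eq_bigr => i _.
  by rewrite !hornerE; ring.
have Q0 : 1 = lead_coef (toC Q) * (-1) ^+ n * \prod_i m i ^+ 2.
  transitivity ((toC Q).[0]).
    by rewrite -[0 in RHS](rmorph0 (real_complex R)) /toC horner_map/= Q01 rmorph1.
  by rewrite HE; congr (_ * _); apply: eq_bigr => i _; rewrite subr0.
have M0 : \prod_i m i ^+ 2 != 0 by apply/prodf_neq0 => i _; rewrite expf_neq0// mass_neq0.
rewrite HE big_split/= prodfV mulrC; congr (_ * _).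
by apply: (mulIf M0); rewrite -Q0 mulVf.
Qed.

(** Multiply [1 / Q(-k^2)] by the Lagrange identity at [x = -k^2]: in the [i]-th summand all factors
    of [Q] but the [i]-th cancel. The square of [m i] is written as a product to match
    [cauchy_kernel] with [d = residue m i * m i]. *)
Lemma inv_horner_masses Q n (m : 'I_n -> R[i]) k : (0 < n)%N ->
    size Q = n.+1 -> Q.[0] = 1 -> masses_of Q m ->
  ((Q.[- k ^+ 2])^-1)%:C =
  \sum_i residue m i * m i * m i / (m i ^+ 2 + (k ^+ 2)%:C).
Proof.
move=> n0 szQ Q01 mQ; have [mpos inj roots] := mQ.
have QE : (Q.[- k ^+ 2])%:C = \prod_i ((m i ^+ 2 + (k ^+ 2)%:C) / m i ^+ 2).
  rewrite -(horner_map (real_complex R)) /= -/(toC Q) (horner_masses _ szQ Q01 mQ).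
  by apply: eq_bigr => i _; rewrite rmorphN opprK.
have m0 i : m i ^+ 2 != 0 by rewrite expf_neq0// mass_neq0.
have mk0 i : m i ^+ 2 + (k ^+ 2)%:C != 0 by exact: sqr_mass_add_neq0.
rewrite fmorphV/= QE -[LHS]mulr1 -[X in _ * X = _](lagrange_sum1 (- (k ^+ 2)%:C) n0 inj) mulr_sumr.
apply: eq_bigr => i _.
have -> : residue m i = (\prod_(j < n | j != i) ((m j ^+ 2 + (k ^+ 2)%:C) / m j ^+ 2))^-1 *
    \prod_(l < n | l != i) ((m l ^+ 2 - - (k ^+ 2)%:C) / (m l ^+ 2 - m i ^+ 2)).
  rewrite -prodfV -big_split/=; apply: eq_bigr => j ji.
  have mij : m j ^+ 2 - m i ^+ 2 != 0.
    by rewrite subr_eq0; apply: contra_neq ji => /inj.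
  by rewrite opprK; field; rewrite mij mass_neq0// -rmorphXn mk0.
rewrite (bigD1 i)//= invfM invf_div.
by ring.
Qed.

Lemma sinc_transform_ext (h h' L L' : R -> R) :
    h =1 h' -> (forall r, 0 < r -> L r = L' r) ->
  sinc_transform h L -> sinc_transform h' L'.
Proof.
move=> /funext <- LL' [mh eh bh I]; split=> // r r0.
by rewrite I// LL'.
Qed.

Lemma Re_sum n (F : 'I_n -> R[i]) : complex.Re (\sum_i F i) = \sum_i complex.Re (F i).
Proof. by elim/big_rec2: _ => // i _ y _ <-; rewrite ReD. Qed.

(** The [m i] cancel and the residues sum to 1. The constant [c] will be 1 for real parts and ['i]
    for imaginary parts. *)
Lemma sum_residue_expC n (m : 'I_n -> R[i]) (c : R[i]) r : (0 < n)%N ->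
    injective (fun i => m i ^+ 2) -> (forall i, 0 < complex.Re (m i)) -> 0 < r ->
  \sum_i complex.Re (c * (residue m i * m i) / m i * (1 - expC (- (r%:C * m i)))) =
  complex.Re (c * (1 - r%:C * yukawa_sum m r)).
Proof.
move=> n0 inj mpos r0; rewrite -Re_sum; congr complex.Re.
transitivity (c * (\sum_i residue m i - r%:C * yukawa_sum m r)); last by rewrite sum_residue.
rewrite /yukawa_sum mulr_sumr -sumrB mulr_sumr.
apply: eq_bigr => i _; rewrite -/(residue m i) mulrA mulfK ?mass_neq0//.
have rC0 : r%:C != 0 by rewrite (inj_eq (@complexI R)) gt_eqF.
by field.
Qed.

(** The terms of the mass expansion may be complex, but [1 / Q(-k^2)] is real, so it is the sum of
    their real parts, which are Cauchy kernels. *)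
Lemma sinc_transform_inv_horner Q n (m : 'I_n -> R[i]) : (0 < n)%N ->
    size Q = n.+1 -> Q.[0] = 1 -> masses_of Q m ->
  sinc_transform (fun k => (Q.[- k ^+ 2])^-1)
    (fun r => complex.Re (1 - r%:C * yukawa_sum m r)).
Proof.
move=> n0 szQ Q01 mQ; have [mpos inj roots] := mQ.
have := sinc_transform_sum (fun i => sinc_transform_cauchy_kernel (1 * (residue m i * m i)) (mpos i)).
apply: sinc_transform_ext => [k|r r0].
  rewrite /cauchy_kernel -Re_sum -[RHS]/(complex.Re ((Q.[- k ^+ 2])^-1)%:C).
  rewrite (inv_horner_masses k n0 szQ Q01 mQ); congr complex.Re.
  by apply: eq_bigr => i _; rewrite mul1r.
by rewrite sum_residue_expC// mul1r.
Qed.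

(* The integral formula, applied to the vanishing imaginary part of 1/Q(-k^2), evaluates
   to that of the Yukawa sum. *)
Lemma Im_yukawa_sum Q n (m : 'I_n -> R[i]) r : (0 < n)%N ->
    size Q = n.+1 -> Q.[0] = 1 -> masses_of Q m -> 0 < r ->
  complex.Im (yukawa_sum m r) = 0.
Proof.
move=> n0 szQ Q01 mQ r0; have [mpos inj roots] := mQ.
(* The extra factor ['i] makes the kernels add up to the real part of ['i / Q(-k^2)], which is 0. *)
have [_ _ _ /(_ r r0)] := sinc_transform_sum
  (fun i => sinc_transform_cauchy_kernel ('i * (residue m i * m i)) (mpos i)).
rewrite sum_residue_expC// => E.
have : pi / 2 * complex.Re ('i * (1 - r%:C * yukawa_sum m r)) = 0.
  rewrite -E; transitivity (Rintegral (@lebesgue_measure R) `]0, +oo[ (fun=> 0)).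
    apply: eq_Rintegral => k _; rewrite /cauchy_kernel -Re_sum.
    rewrite (_ : \sum_i _ = 'i * ((Q.[- k ^+ 2])^-1)%:C) ?Re_mulr ?mul0r ?mulr0//.
    rewrite (inv_horner_masses k n0 szQ Q01 mQ) mulr_sumr.
    by apply: eq_bigr => i _; rewrite !mulrA.
  by rewrite Rintegral_cst// mul0r.
move/eqP; rewrite mulf_eq0 gt_eqF ?divr_gt0 ?pi_gt0//=.
(* For the Yukawa sum [u + i v] the remaining factor is [r v], and [r] is nonzero. *)
case: (yukawa_sum m r) => u v /=.
rewrite !(mul0r, add0r, sub0r, mul1r, addr0, subr0, oppr0) opprK.
by rewrite mulf_eq0 gt_eqF//= => /eqP.
Qed.

End masses.

(** * Principal value *)

Section principal_value.
Context {R : realType}.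
Notation mu := (@lebesgue_measure R).
Implicit Types (h g : R -> R) (k r e : R).

(** The pushforward formula for negation, under which Lebesgue measure is invariant. *)
Lemma Rintegral_oppr (A : set R) g :
    measurable (A : set (measurableTypeR R)) -> measurable_fun setT g ->
    mu.-integrable (-%R @^-1` A) (EFin \o (g \o -%R)) ->
  Rintegral mu A g = Rintegral mu (-%R @^-1` A) (g \o -%R).
Proof.
move=> mA mg ig; rewrite /Rintegral; congr fine.
have mgE : measurable_fun setT (EFin \o g) by exact/measurable_EFinP.
have h := @integral_pushforward _ _ _ _ _ (-%R : measurableTypeR R -> measurableTypeR R) (@oppr_measurable R setT) mu A (EFin \o g) mgE ig mA.
rewrite -[RHS]h.
by apply: eq_measure_integral => B mB _; exact/esym/lebesgue_measureN.
Qed.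

Definition pv_integrand h r k : R[i] := expC ('i * (k * r)%:C) / k%:C * (h k)%:C.

Lemma pv_integrandE h r k : pv_integrand h r k =
  (cos (r * k) / k * h k) +i* (sin (r * k) / k * h k).
Proof.
have -> : pv_integrand h r k = expC ((r * k) *i) * (k^-1)%:C * (h k)%:C.
  rewrite /pv_integrand -(fmorphV (real_complex R)); congr (expC _ * _ * _).
  by apply/eqP; rewrite eq_complex /=; apply/andP; split; apply/eqP; ring.
rewrite /expC/= expR0; apply/eqP; rewrite eq_complex /=.
by apply/andP; split; apply/eqP; ring.
Qed.

Lemma measurable_norm_ge e : measurable ([set k : R | e <= `|k|] : set (measurableTypeR R)).
Proof.
rewrite [X in measurable X](_ : _ = Num.norm @^-1` `[e, +oo[); last first.
  by apply/seteqP; split=> x /=; rewrite in_itv/= andbT.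
rewrite -[X in measurable X]setTI.
by apply: (continuous_measurable_fun (@norm_continuous R R)) => //; exact: measurable_itv.
Qed.

Lemma norm_ge_setU e : 0 < e -> [set k : R | e <= `|k|] = `]-oo, (- e)] `|` `[e, +oo[.
Proof.
move=> e0; apply/seteqP; split=> x /=; rewrite !in_itv/= andbT ler_normr lerNr orbC.
  by move=> /orP.
by move=> /orP.
Qed.

Lemma measurable_cosc (D : set R) r : measurable_fun D (fun k => cos (r * k) / k).
Proof.
apply: measurable_funM; last exact: measurable_fun_invr.
apply: measurable_funTS; apply: continuous_measurable_fun; exact: continuous_cosM.
Qed.

(** On the symmetric truncated domain the cosine part is odd and contributes 0. The even sine part
    contributes twice its integral from [e] on, which tends to the half-line integral because the
    integrand is integrable up to 0. *)
Lemma pv_sinc_transform h L r : 0 < r -> sinc_transform h L ->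
  ex_pv (pv_integrand h r) /\ pv (pv_integrand h r) = (pi * L r) *i.
Proof.
move=> r0 [mh eh [C hC] I].
pose gs k := sin (r * k) / k * h k.
pose gc k := cos (r * k) / k * h k.
have ms (D : set R) : measurable_fun D gs.
  by apply: measurable_funM; [exact: measurable_sinc|exact: measurable_funTS].
have mc (D : set R) : measurable_fun D gc.
  by apply: measurable_funM; [exact: measurable_cosc|exact: measurable_funTS].
have isc (D : set R) : measurable (D : set (measurableTypeR R)) -> mu.-integrable D (EFin \o gs).
  move=> mD; apply: (@integrable_lorentzian_bound _ _ _ (`|r| * C)) => //.
  by move=> k _; rewrite normrM -mulrA ler_pM// normr_sinc_le.
(* Only away from 0 is [cos(r k) / k] bounded, here by [1 / e]. *)
have ic e : 0 < e -> mu.-integrable [set k : R | e <= `|k|] (EFin \o gc).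
  move=> e0; apply: (@integrable_lorentzian_bound _ _ _ (e^-1 * C)) => //.
    exact: measurable_norm_ge.
  move=> k /= ek; rewrite normrM -mulrA ler_pM// normrM normfV.
  rewrite -[e^-1]mul1r ler_pM ?invr_ge0// ?cos_max// lef_pV2 ?posrE//.
  exact: lt_le_trans ek.
have opS e : -%R @^-1` [set k : R | e <= `|k|] = [set k : R | e <= `|k|].
  by apply/seteqP; split=> x /=; rewrite normrN.
have gcN : gc \o -%R = (fun k => - gc k).
  by apply/funext => k; rewrite /gc /= mulrN cosN invrN mulrN eh mulNr.
have gsN : gs \o -%R = gs.
  by apply/funext => k; rewrite /gs /= mulrN sinN invrN mulrNN eh.
have icN e : 0 < e -> mu.-integrable [set k : R | e <= `|k|] (EFin \o (fun k => - gc k)).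
  move=> e0; exact: (integrableN (ic e e0)).
have Ic e : 0 < e -> Rintegral mu [set k : R | e <= `|k|] gc = 0.
  move=> e0.
  have : Rintegral mu [set k : R | e <= `|k|] gc = - Rintegral mu [set k : R | e <= `|k|] gc.
    rewrite {1}Rintegral_oppr//; last 2 first.
    - exact: measurable_norm_ge.
    - by rewrite opS gcN; exact: icN.
    rewrite opS gcN -mulN1r -RintegralZl//; last 2 first.
    - exact: measurable_norm_ge.
    - exact: ic.
    by apply: eq_Rintegral => k _; rewrite mulN1r.
  lra.
pose y e := Rintegral mu `[e, +oo[ gs.
have Is e : 0 < e -> Rintegral mu [set k : R | e <= `|k|] gs = 2 * y e.
  move=> e0; rewrite (norm_ge_setU e0) Rintegral_setU//; last 2 first.
  - by apply: isc; rewrite -(norm_ge_setU e0); exact: measurable_norm_ge.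
  - apply/disj_setPS => t [] /=; rewrite !in_itv/= andbT => te et.
    by have := le_trans et te; lra.
  rewrite mulr_natl mulr2n; congr (_ + _).
  have pre : -%R @^-1` (`]-oo, (- e)]%classic : set R) = `[e, +oo[%classic.
    by apply/seteqP; split=> x /=; rewrite !in_itv/= andbT lerN2.
  rewrite Rintegral_oppr//.
  - by rewrite pre gsN.
  - by rewrite pre gsN; exact: isc.
have cy : y e @[e --> 0^'+] --> pi / 2 * L r.
  (* The one-sided limit is tested along sequences of positive numbers tending to 0, so that
     dominated convergence applies. *)
  rewrite -I//; apply/cvg_at_rightP => u [u0 cu].
  have E n : y (u n) = Rintegral mu `]0, +oo[ (gs \_ `[u n, +oo[).
    rewrite -Rintegral_mkcondr /y; congr (Rintegral _ _ _).
    apply/seteqP; split=> x /=; rewrite !in_itv/= ?andbT; last by case.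
    by move=> h1; split=> //; exact: lt_le_trans h1.
  under eq_fun do rewrite E.
  apply: (dominated_cvg_Rintegral (g := fun x => `|gs x|)) => //.
  - by move=> n; apply/measurable_restrict => //.
  - move=> x; rewrite /= in_itv/= andbT => x0.
    apply: cvg_near_cst.
    have : \forall n \near \oo, u n < x by exact: (cvgr_lt 0 cu).
    apply: filterS => n unx.
    by rewrite patchT// inE /= in_itv/= (ltW unx).
  - by apply: integrable_norm; apply: isc; exact: measurable_itv.
  - by move=> n x _; rewrite patchE; case: ifP => // _; rewrite normr0.
have tE e : 0 < e -> truncated_integral (pv_integrand h r) e = (2 * y e) *i.
  move=> e0; rewrite /truncated_integral /integralC.
  rewrite -(Is e e0) -(Ic e e0).
  by congr (_ +i* _); apply: eq_Rintegral => k _; rewrite pv_integrandE.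
have ct : truncated_integral (pv_integrand h r) e @[e --> 0^'+] --> ((pi * L r) *i : R[i]^o).
  (* The order on [R[i]] forces a positive [eps] to be real, which reduces the claim to a real
     limit. *)
  apply/cvgrPdist_lt => /= eps; rewrite ltcE /= => /andP[/eqP imeps reps].
  have c2 : 2 * y e @[e --> 0^'+] --> pi * L r.
    rewrite (_ : pi * L r = 2 * (pi / 2 * L r)); last by field.
    by apply: cvgM; [exact: cvg_cst|exact: cy].
  move/cvgrPdist_lt: c2 => /(_ _ reps) c2.
  near=> e.
  have e0 : 0 < e by near: e; exact: nbhs_right_gt.
  rewrite tE// normc_def ltcE /= imeps eqxx/= !subrr expr0n/= add0r sqrtr_sqr.
  by near: e.
split.
  split; last by apply/cvg_ex; exists ((pi * L r) *i).
  move=> e e0; rewrite /integrableC.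
  rewrite (_ : (fun k => (complex.Re _)%:E) = EFin \o gc); last first.
    by apply/funext => k; rewrite pv_integrandE.
  rewrite (_ : (fun k => (complex.Im _)%:E) = EFin \o gs); last first.
    by apply/funext => k; rewrite pv_integrandE.
  by split; [exact: ic|apply: isc; exact: measurable_norm_ge].
exact: cvg_lim ct.
Unshelve. all: by end_near. Qed.

End principal_value.

(** * Normalization at zero and evaluation of the potential *)

Lemma horner_Q0_0 (R : realType) kappa (F1 F2 : {poly R}) : (Q0 kappa F1 F2).[0] = 1.
Proof.
by rewrite /Q0 hornerD hornerN hornerZ hornerM hornerX !(mul0r, mulr0) oppr0 addr0 hornerC.
Qed.

Lemma horner_Q2_0 (R : realType) kappa (F2 : {poly R}) : (Q2 kappa F2).[0] = 1.
Proof.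
by rewrite /Q2 hornerD hornerZ hornerM hornerX !(mul0r, mulr0) addr0 hornerC.
Qed.

Unset Implicit Arguments.
Set Strict Implicit.

Theorem mainTheorem2 (R : realType) (F1 F2 : {poly R}) (G M kappa : R)
    (n0 n2 : nat) (m0 : 'I_n0 -> R[i]) (m2 : 'I_n2 -> R[i])
    (G_gt0 : 0 < G) (M_gt0 : 0 < M) (kappaE : kappa ^+ 2 = 32 * pi * G)
    (n0_gt0 : (0 < n0)%N) (n2_gt0 : (0 < n2)%N)
    (degQ0 : size (Q0 kappa F1 F2) = n0.+1)
    (degQ2 : size (Q2 kappa F2) = n2.+1)
    (no_tachyon0 : forall x : R, x < 0 -> ~~ root (Q0 kappa F1 F2) x)
    (no_tachyon2 : forall x : R, x < 0 -> ~~ root (Q2 kappa F2) x)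
    (simple0 : simple_roots (Q0 kappa F1 F2))
    (simple2 : simple_roots (Q2 kappa F2))
    (massesE0 : masses_of (Q0 kappa F1 F2) m0)
    (massesE2 : masses_of (Q2 kappa F2) m2) :
  forall r : R, 0 < r ->
    [/\ ex_pv (integrand kappa F1 F2 r),
        phi kappa G M F1 F2 r =
          - (G * M)%:C * ((r^-1)%:C - (4 / 3)%:C * yukawa_sum m2 r
                          + (1 / 3)%:C * yukawa_sum m0 r)
      & phi kappa G M F1 F2 r \is Num.real].
Proof.
move=> r r0.
have Q00 := horner_Q0_0 kappa F1 F2; have Q20 := horner_Q2_0 kappa F2.
have s0 := sinc_transform_inv_horner n0_gt0 degQ0 Q00 massesE0.
have s2 := sinc_transform_inv_horner n2_gt0 degQ2 Q20 massesE2.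
(* The two constant terms are 4/3 and -1/3; their sum 1 is the coefficient of the Newtonian
   [1 / r]. *)
have s := sinc_transformD (sinc_transformZ (4 / 3) s2) (sinc_transformZ (- (1 / 3)) s0).
have [ex_f pv_f] := pv_sinc_transform r0 s.
have fE : integrand kappa F1 F2 r = pv_integrand
    ((fun k => 4 / 3 * ((Q2 kappa F2).[- k ^+ 2])^-1) \+
     (fun k => - (1 / 3) * ((Q0 kappa F1 F2).[- k ^+ 2])^-1)) r.
  apply/funext => k; rewrite /integrand /pv_integrand; congr (_ * _%:C).
  by rewrite /= !invfM; ring.
have phiE : phi kappa G M F1 F2 r = - (G * M)%:C * ((r^-1)%:C - (4 / 3)%:C * yukawa_sum m2 r
                          + (1 / 3)%:C * yukawa_sum m0 r).
  (* The transforms retain only the real parts of the Yukawa sums; since the imaginary parts vanish,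
     these are the sums themselves. *)
  have i0 := Im_yukawa_sum n0_gt0 degQ0 Q00 massesE0 r0.
  have i2 := Im_yukawa_sum n2_gt0 degQ2 Q20 massesE2 r0.
  (* The prefactor [i G M / (pi r)] times [i pi L(r)] is [- G M L(r) / r]. *)
  rewrite /phi fE pv_f /=.
  case: (yukawa_sum m0 r) (yukawa_sum m2 r) i0 i2 => [u0 v0] [u2 v2] /= -> ->.
  apply/eqP; rewrite eq_complex /=; apply/andP; split; apply/eqP; last by ring.
  by move: (@pi R) (pi_gt0 R) => p p0; field; rewrite !gt_eqF.
split; [by rewrite fE | exact: phiE |].
rewrite phiE; have i0 := Im_yukawa_sum n0_gt0 degQ0 Q00 massesE0 r0.
have i2 := Im_yukawa_sum n2_gt0 degQ2 Q20 massesE2 r0.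
case: (yukawa_sum m0 r) (yukawa_sum m2 r) i0 i2 => [u0 v0] [u2 v2] /= -> ->.
by rewrite complex_real /=; apply/eqP; ring.
Qed.
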